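(* The property ČF$T_1$ is a fuzzy closure property: if $\theta:(X,c)\to(Y,d)$ is a ČF-homeomorphism between fuzzy closure spaces and $(X,c)$ is ČF$T_1$, then $(Y,d)$ is ČF$T_1$.
   Context: $I=[0,1]$; a fuzzy (sub)set of a non-empty set $X$ is a map $f:X\to I$, and $I^X$ is the set of all of them, ordered pointwise, with $\vee,\wedge$ pointwise supremum/infimum. $\underline 0$ is the constant $0$ fuzzy set; the complement is $\mathfrak{Co}(f)(x)=1-f(x)$. For $x\in X$ and $0<\lambda\le1$, the fuzzy point $x_\lambda$ has value $\lambda$ at $x$ and $0$ elsewhere; $x_\lambda\in f$ means $x_\lambda\le f$, i.e. $\lambda\le f(x)$. Fuzzy points $x_\lambda,y_\gamma$ are distinct if $x\ne y$. A fuzzy closure space is a pair $(X,c)$ with $X$ a non-empty set and $c:I^X\to I^X$ satisfying $c(\underline 0)=\underline 0$, $f\le c(f)$, and $c(f\vee g)=c(f)\vee c(g)$ for all $f,g\in I^X$ (idempotency is not required). For $\theta:X\to Y$ and $f\in I^X$, $\theta(f)(y)=\sup\{f(x):\theta(x)=y\}$ if $\theta^{-1}(y)\ne\emptyset$, and $0$ otherwise. $\theta:(X,c)\to(Y,d)$ is ČF-continuous if $\theta(c(f))\le d(\theta(f))$ for all $f\in I^X$; it is a ČF-homeomorphism if it is bijective and both $\theta$ and $\theta^{-1}$ are ČF-continuous. A fuzzy closure property is a property of fuzzy closure spaces preserved by ČF-homeomorphisms. $(X,c)$ is ČF$T_1$ if for every two distinct fuzzy points $x_\lambda,y_\gamma$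 of $X$, both $x_\lambda\in\mathfrak{Co}(c(y_\gamma))$ and $y_\gamma\in\mathfrak{Co}(c(x_\lambda))$. *)

(* Defs.v *)
From HB Require Import structures.
From mathcomp Require Import all_boot all_order all_algebra.
From mathcomp Require Import boolp classical_sets reals interval_inference.

Set Implicit Arguments.
Unset Strict Implicit.
Unset Printing Implicit Defensive.

Import Order.TTheory GRing.Theory Num.Theory.

Local Open Scope classical_set_scope.
Local Open Scope ring_scope.

(* The order [<=%O] and the join [`|`%O] on this type are the pointwise ones
   that boolp puts on functions into an ordered type. *)
Definition fuzzy_set (R : realType) (X : Type) : Type := X -> {i01 R}.

Definition fuzzy_empty (R : realType) (X : Type) : fuzzy_set R X :=
  fun=> 0%:i01.

Definition fuzzy_compl (R : realType) (X : Type) (f : fuzzy_set R X) :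
    fuzzy_set R X :=
  fun x => (1 - (f x)%:num)%:i01.

(* A fuzzy point only when [0 < l]; this is required wherever it is used. *)
Definition fuzzy_point (R : realType) (X : Type) (x : X) (l : {i01 R}) :
    fuzzy_set R X :=
  fun z => if `[< z = x >] then l else 0%:i01.

Definition fuzzy_in (R : realType) (X : Type) (x : X) (l : {i01 R})
    (f : fuzzy_set R X) : Prop :=
  (fuzzy_point x l <= f)%O.

Record fuzzy_closure_space (R : realType) := FuzzyClosureSpace {
  carrier :> Type;
  carrier_nonempty : inhabited carrier;
  fclosure : fuzzy_set R carrier -> fuzzy_set R carrier;
  fclosure0 : fclosure (@fuzzy_empty R carrier) = @fuzzy_empty R carrier;
  fclosure_ge : forall f : fuzzy_set R carrier, (f <= fclosure f)%O;
  fclosureU : forall f g : fuzzy_set R carrier,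
    fclosure (f `|` g)%O = (fclosure f `|` fclosure g)%O }.

Section Image.
Variables (R : realType) (X Y : Type) (theta : X -> Y) (f : fuzzy_set R X).

Definition fuzzy_image_val (y : Y) : R :=
  if `[< exists x, theta x = y >]
  then sup [set (f x)%:num | x in [set x | theta x = y]]
  else 0.

Lemma fuzzy_image_val_le1 y : fuzzy_image_val y <= 1.
Proof.
rewrite /fuzzy_image_val; case: asboolP => [[x xy]|_]; last exact: ler01.
by apply: ge_sup; [exists (f x)%:num, x | move=> _ [z _ <-]].
Qed.

Lemma fuzzy_image_val_ge0 y : 0 <= fuzzy_image_val y.
Proof.
rewrite /fuzzy_image_val; case: asboolP => // -[x xy].
apply: (@le_trans _ _ (f x)%:num) => //; apply: ub_le_sup; last by exists x.
by exists 1 => _ [z _ <-].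
Qed.

Definition fuzzy_image : fuzzy_set R Y :=
  fun y => Itv01 (fuzzy_image_val_ge0 y) (fuzzy_image_val_le1 y).

End Image.

Definition CF_continuous (R : realType) (X Y : fuzzy_closure_space R)
    (theta : X -> Y) : Prop :=
  forall f : fuzzy_set R X,
    (fuzzy_image theta (fclosure f) <= fclosure (fuzzy_image theta f))%O.

Definition CF_homeomorphism (R : realType) (X Y : fuzzy_closure_space R)
    (theta : X -> Y) : Prop :=
  exists theta' : Y -> X,
    [/\ cancel theta theta', cancel theta' theta,
        CF_continuous theta & CF_continuous theta'].

Definition fuzzy_closure_property (R : realType)
    (P : fuzzy_closure_space R -> Prop) : Prop :=
  forall (X Y : fuzzy_closure_space R) (theta : X -> Y),
    CF_homeomorphism theta -> P X -> P Y.

Definition CF_T1 (R : realType) (X : fuzzy_closure_space R) : Prop :=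
  forall (x y : X) (l g : {i01 R}),
    0 < l%:num -> 0 < g%:num -> x <> y ->
    fuzzy_in x l (fuzzy_compl (fclosure (fuzzy_point y g))) /\
    fuzzy_in y g (fuzzy_compl (fclosure (fuzzy_point x l))).

(* Main.v *)
(** Since [theta] is bijective, the image of [f] under the continuous inverse
    [theta'] is [f \o theta], so continuity of [theta'] bounds the closure of
    the fuzzy point [y_g] of [Y], at [z], by the closure of [(theta' y)_g] of
    [X], at [theta' z]. Complementing reverses this inequality, so the T1
    memberships pull back from [X] to [Y] along [theta']. *)

Require Import Defs.
From mathcomp Require Import all_boot all_order all_algebra.
From mathcomp Require Import boolp classical_sets reals interval_inference.

Set Implicit Arguments.
Unset Strict Implicit.
Unset Printing Implicit Defensive.

Import Order.TTheory GRing.Theory Num.Theory.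

Local Open Scope classical_set_scope.
Local Open Scope ring_scope.

(** Away from [x] the fuzzy point is 0, below every grade, so only the value at [x] is a
    constraint. *)
Lemma fuzzy_inE (R : realType) (X : Type) (x : X) (l : {i01 R})
    (f : fuzzy_set R X) : fuzzy_in x l f <-> l%:num <= (f x)%:num.
Proof.
split=> [/lefP/(_ x)|lf]; first by rewrite /fuzzy_point asboolT.
apply/lefP => z; rewrite /fuzzy_point; case: asboolP => [->|_]; first exact: lf.
by change (0 <= (f z)%:num).
Qed.

(** The fibre of [theta] over [y] is the singleton of [theta' y], so the supremum runs over a single
    value. *)
Lemma fuzzy_image_can (R : realType) (X Y : Type) (theta : X -> Y)
    (theta' : Y -> X) (f : fuzzy_set R X) :
  cancel theta theta' -> cancel theta' theta ->
  fuzzy_image theta f = f \o theta'.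
Proof.
move=> thetaK theta'K; apply/funext => y; apply/val_inj => /=.
rewrite /fuzzy_image_val asboolT; last by exists (theta' y).
rewrite (_ : [set x | theta x = y] = [set theta' y]) ?image_set1 ?sup1//.
by apply/seteqP; split=> [x /= <-|_ ->] /=.
Qed.

Lemma fuzzy_point_comp_can (R : realType) (X Y : Type) (theta : X -> Y)
    (theta' : Y -> X) (x : X) (l : {i01 R}) :
  cancel theta theta' -> cancel theta' theta ->
  fuzzy_point x l \o theta' = fuzzy_point (theta x) l.
Proof.
move=> thetaK theta'K; apply/funext => y; rewrite /fuzzy_point /=.
by congr (if _ then _ else _); apply: asbool_equiv_eq; split=> [<-|->].
Qed.

Theorem theorem5p5 (R : realType) : fuzzy_closure_property (@CF_T1 R).
Proof.
move=> X Y theta [theta' [thetaK theta'K _ cont']] T1X.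
have closure_le (y z : Y) (g : {i01 R}) :
    (Defs.fclosure (fuzzy_point y g) z)%:num <=
    (Defs.fclosure (fuzzy_point (theta' y) g) (theta' z))%:num.
  have /lefP/(_ (theta' z)) := cont' (fuzzy_point y g).
  (* The roles of [theta] and [theta'] are exchanged here: both images under [theta'] become
     compositions with [theta], which sends [theta' z] back to [z]. *)
  rewrite !(fuzzy_image_can _ theta'K thetaK).
  by rewrite (fuzzy_point_comp_can _ _ theta'K thetaK) /= theta'K.
have in_compl (y z : Y) (l g : {i01 R}) :
    fuzzy_in (theta' z) l (fuzzy_compl (Defs.fclosure (fuzzy_point (theta' y) g))) ->
    fuzzy_in z l (fuzzy_compl (Defs.fclosure (fuzzy_point y g))).
  move=> /fuzzy_inE le_l; apply/fuzzy_inE; apply: (le_trans le_l) => /=.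
  by rewrite lerD2l lerN2.
move=> y z l g l0 g0 yz.
have /(T1X _ _ _ _ l0 g0)[] : theta' y <> theta' z by move/(can_inj theta'K).
by move=> /in_compl ? /in_compl.
Qed.
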